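(* Let $n\in\mathbb{N}=\{1,2,3,\dots\}$ and $\lambda\in(0,1]$, and for $\alpha\in(0,2)$ let $$R(\alpha,n,\lambda):=\frac{\alpha\lambda^\alpha\sin \alpha\pi}{\pi}\int_0^1 t^{\alpha-1}(1-t)^{\alpha n}\left\{\frac{1}{|t^\alpha-\lambda^\alpha e^{-i\alpha\pi}|^2}+\frac{\lambda^{\alpha n}}{|e^{-i\alpha\pi}-(\lambda t)^\alpha|^2}\right\}dt.$$ Then $$0< R(\alpha,n,\lambda)<1-\alpha<1\quad\text{for }\alpha\in(0,1),$$ and $$0> R(\alpha,n,\lambda)>1-\alpha>-1\quad\text{for }\alpha\in(1,2).$$ *)

(* Defs.v *)
From HB Require Import structures.
From mathcomp Require Import all_boot all_order all_algebra.
From mathcomp Require Import all_classical all_reals all_analysis.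
From mathcomp Require Import complex.

Set Implicit Arguments.
Unset Strict Implicit.
Unset Printing Implicit Defensive.

Import Order.TTheory GRing.Theory Num.Theory.
Import numFieldNormedType.Exports.

Local Open Scope classical_set_scope.
Local Open Scope ring_scope.
Local Open Scope complex_scope.

(* e^{i theta}, by Euler's formula *)
Definition expi (R : realType) (theta : R) : R[i] := cos theta +i* sin theta.

(* The integrand is nonnegative, so the Lebesgue integral agrees with the
   (for alpha < 1, improper) Riemann integral.  The junk value of t `^ (alpha - 1)
   at t = 0 is irrelevant, {0} being a null set.  [\int] is real-valued here
   (Rintegral): it would be 0 if the integral diverged. *)
Definition remainder (R : realType) (alpha : R) (n : nat) (lambda : R) : R :=
  alpha * lambda `^ alpha * sin (alpha * pi) / pi *
  \int[lebesgue_measure]_(t in `[0, 1])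
    (t `^ (alpha - 1) * (1 - t) `^ (alpha * n%:R) *
     (1 / Normc.normc ((t `^ alpha)%:C
            - (lambda `^ alpha)%:C * expi (- (alpha * pi))) ^+ 2
      + lambda `^ (alpha * n%:R)
          / Normc.normc (expi (- (alpha * pi)) - ((lambda * t) `^ alpha)%:C) ^+ 2)).

(* Main.v *)
Require Import Defs.
From mathcomp Require Import all_boot all_order all_algebra.
From mathcomp Require Import all_classical all_reals all_analysis.
From mathcomp Require Import measurable_realfun complex ring lra.

Set Implicit Arguments.
Unset Strict Implicit.
Unset Printing Implicit Defensive.

Import Order.TTheory GRing.Theory Num.Theory.
Import numFieldNormedType.Exports.

Local Open Scope classical_set_scope.
Local Open Scope ring_scope.

(** Put [m = lambda^alpha], [c = cos (alpha pi)], [s = |sin (alpha pi)|].  Dropping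
    the factors [(1 - t)^(alpha n)] and [lambda^(alpha n)], both at most 1, from the
    integrand bounds [pi |R|] by the integral over [0, 1] of the derivative of
      [G t = atan ((t^alpha - m c) / (m s)) - atan ((t^(-alpha) - m c) / (m s))].
    The two arctangents cancel at [t = 1], and [G > - pi/2 - atan (c / s)] on
    [t > 0], so that [pi |R| < pi/2 + atan (c / s) = pi |1 - alpha|].  The
    inequality is strict because [(1 - t)^(alpha n)] stays away from 1 on
    [[1/2, 1]]; [R] does not vanish because the dropped factors stay away from 0
    on [[1/4, 1/2]]. *)

(** * Integral estimates from an antiderivative on the open half-line *)

Lemma integral_scaled_FTC2 (R : realType) (g G : R -> R) (k x y : R) :
  x < y ->
  (forall t, x <= t <= y -> {for t, continuous g}) ->
  (forall t : R, x <= t <= y -> is_derive t 1 G (g t)) ->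
  (\int[lebesgue_measure]_(t in `[x, y]) (k * g t)%:E = (k * (G y - G x))%:E)%E.
Proof.
move=> xy cg dG.
have dkG t : x <= t <= y -> is_derive t 1 (fun u => k * G u : R) (k * g t).
  by move=> txy; have := @is_deriveZ _ _ _ G k _ _ _ (dG _ txy).
have ckG t : x <= t <= y -> {for t, continuous (fun u => k * G u : R)}.
  by move=> /dkG ?; apply/differentiable_continuous/derivable1_diffP.
rewrite mulrBr EFinB.
apply: (@continuous_FTC2 _ (fun t => k * g t) (fun u => k * G u)) => //.
- apply/continuous_in_subspaceT => t /[!inE] /=; rewrite in_itv/= => /cg ct.
  by apply: (@continuousM _ _ (cst k) g) => //; exact: cst_continuous.
- split.
  + move=> t /[!in_itv]/= /andP[/ltW xt /ltW ty].
    by have := dkG t; rewrite xt ty => -[].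
  + by apply: cvg_at_right_filter; apply: ckG; rewrite lexx ltW.
  + by apply: cvg_at_left_filter; apply: ckG; rewrite lexx ltW.
- move=> t /[!in_itv]/= /andP[/ltW xt /ltW ty].
  by rewrite derive1E; apply: (@derive_val _ _ _ _ _ _ _ (dkG t _)); rewrite xt.
Qed.

(** [L] stands in for the limit of [G] at 0, so [G] is never evaluated there. The factor [q < 1]
    makes the upper bound strict and [p > 0] makes the integral positive. The extended integral is
    shown equal to a real number because a divergent one would give a real-valued integral its
    default 0. *)
Lemma integral_bounds_by_antiderivative (R : realType) (f g G : R -> R)
    (p q L : R) :
  measurable_fun setT f ->
  (forall t, 0 < t -> {for t, continuous g}) ->
  (forall t : R, 0 < t -> is_derive t 1 G (g t)) ->
  (forall t, 0 < t -> L <= G t) ->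
  G 4^-1 < G 2^-1 -> G 2^-1 < G 1 ->
  (forall t, 0 < t <= 1 -> 0 <= f t <= g t) ->
  0 < p -> (forall t, 4^-1 <= t <= 2^-1 -> p * g t <= f t) ->
  q < 1 -> (forall t, 2^-1 <= t <= 1 -> f t <= q * g t) ->
  exists2 r : R, 0 < r < G 1 - L &
    (\int[lebesgue_measure]_(t in `[0%R, 1%R]) (f t)%:E = r%:E)%E.
Proof.
move=> mf cg dG LG G42 G21 fg p0 pgf q1 fqg.
pose mu := @lebesgue_measure R.
have mfE (D : set (measurableTypeR R)) : measurable_fun D (fun t => (f t)%:E).
  by apply: measurable_funTS; exact/measurable_EFinP.
have FTC (k x y : R) : 0 < x -> x < y ->
    (\int[mu]_(t in `[x, y]) (k * g t)%:E = (k * (G y - G x))%:E)%E.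
  move=> x0 xy; apply: integral_scaled_FTC2 => // t /andP[xt _].
    by apply: cg; exact: lt_le_trans xt.
  by apply: dG; exact: lt_le_trans xt.
have mg (k x y : R) : 0 < x -> measurable_fun `[x, y] (fun t => (k * g t)%:E).
  move=> x0; apply/measurable_EFinP/measurable_funM => //.
  apply: subspace_continuous_measurable_fun => //.
  apply/continuous_in_subspaceT => t /[!inE] /=; rewrite in_itv/= => /andP[xt _].
  by apply: cg; exact: lt_le_trans xt.
have f0 t : 0 < t -> t <= 1 -> (0 <= (f t)%:E)%E.
  by move=> t0 t1; rewrite lee_fin; have /andP[] := fg t (introT andP (conj t0 t1)).
(* The hypotheses on [f] and [g] concern only [t > 0]; the endpoint 0 is a null set. *)
have IoE : (\int[mu]_(t in `[0%R, 1%R]) (f t)%:E =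
            \int[mu]_(t in `]0%R, 1%R]) (f t)%:E)%E.
  by rewrite -integral_itv_obnd_cbnd//; exact: mfE.
have le_FTC (k x y : R) : 0 < x -> x < y -> y <= 1 ->
    (forall t, x <= t <= y -> f t <= k * g t) ->
    (\int[mu]_(t in `[x, y]) (f t)%:E <= (k * (G y - G x))%:E)%E.
  move=> x0 xy y1 fk; rewrite -FTC//; apply: ge0_le_integral => //.
  - move=> t /=; rewrite in_itv/= => /andP[xt ty]; apply: f0.
      exact: lt_le_trans xt.
    exact: le_trans y1.
  - exact: mg.
have lower : ((p * (G 2^-1 - G 4^-1))%:E <=
              \int[mu]_(t in `[0%R, 1%R]) (f t)%:E)%E.
  rewrite IoE -FTC; [|lra|lra].
  apply: (@le_trans _ _ (\int[mu]_(t in `[4^-1%R, 2^-1%R]) (f t)%:E)%E).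
    apply: ge0_le_integral => //.
    - move=> t /=; rewrite in_itv/= => /andP[xt ty].
      have /fg/andP[? ?]: 0 < t <= 1 by apply/andP; split; lra.
      by rewrite lee_fin mulr_ge0//; lra.
    - by apply: mg; lra.
  apply: ge0_subset_integral => //.
  - by move=> t /=; rewrite in_itv/= => /andP[? ?]; exact: f0.
  - by move=> t /=; rewrite !in_itv/= => /andP[? ?]; apply/andP; split; lra.
(* Since [g] may be unbounded at 0, the bound is proved on [[1/(k+3), 1]] and
   passed to the limit. *)
pose B := (G 2^-1 - L) + q * (G 1 - G 2^-1).
have tail (k : nat) :
    (\int[mu]_(t in `[(k.+3%:R)^-1%R, 1%R]) (f t)%:E <= B%:E)%E.
  set x : R := k.+3%:R^-1.
  have x0 : 0 < x by rewrite invr_gt0.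
  (* The shift by 3 puts [x] strictly below 1/2, where the interval is split: the left piece uses
     [f <= g], with factor 1, and the right piece uses [f <= q * g]. *)
  have x2 : x < 2^-1 by rewrite ltf_pV2 ?posrE// ltr_nat.
  rewrite (@itv_bndbnd_setU _ _ _ (BLeft 2^-1)); last 2 first.
  - by rewrite bnd_simp ltW.
  - by rewrite bnd_simp; lra.
  rewrite ge0_integral_setU//; first last.
  - apply/disj_setPS => t [] /=; rewrite !in_itv/=.
    by move=> /andP[_ t2] /andP[t3 _]; lra.
  - by move=> t []; rewrite /= in_itv/= => /andP[? ?]; apply: f0; lra.
  rewrite /B EFinD; apply: leeD.
  - apply: (@le_trans _ _ ((1 * (G 2^-1 - G x))%:E)).
      rewrite integral_itv_bndo_bndc; last exact: mfE.
      apply: le_FTC => //; first by lra.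
      by move=> t /andP[xt t2]; rewrite mul1r; have /fg/andP[] : 0 < t <= 1
        by apply/andP; split; lra.
    by rewrite lee_fin mul1r lerD2l lerN2 LG.
  - by apply: le_FTC => //; lra.
have upper : (\int[mu]_(t in `[0%R, 1%R]) (f t)%:E <= B%:E)%E.
  have bigE : `]0%R, 1%R]%classic =
      \bigcup_(k : nat) `[(k.+3%:R)^-1%R : R, 1%R]%classic.
    apply/seteqP; split => t /=; rewrite in_itv/=.
      move=> /andP[t0 t1].
      have [N _ /(_ N (leqnn _)) /= tN] := near_infty_natSinv_lt (PosNum t0).
      exists N => //=; rewrite in_itv/= t1 andbT (le_trans _ (ltW tN))//.
      by rewrite lef_pV2 ?posrE// ler_nat ltnW// ltnW.
    move=> [k _] /=; rewrite in_itv/= => /andP[kt ->]; rewrite andbT.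
    by apply: lt_le_trans kt; rewrite invr_gt0.
  have cvgI : (\int[mu]_(t in `[(k.+3%:R)^-1%R, 1%R]) (f t)%:E @[k --> \oo] -->
      \int[mu]_(t in `[0%R, 1%R]) (f t)%:E)%E.
    rewrite IoE bigE; apply: ge0_nondecreasing_set_cvg_integral => //.
    - apply/nondecreasing_seqP => k; rewrite subsetEset; apply: subset_itvr.
      by rewrite bnd_simp lef_pV2 ?posrE// ler_nat.
    - move=> k t /=; rewrite in_itv/= => /andP[kt t1]; apply: f0 => //.
      by apply: lt_le_trans kt; rewrite invr_gt0.
  rewrite -(cvg_lim _ cvgI)//; apply: lime_le.
    by apply/cvg_ex; eexists; exact: cvgI.
  by near=> k; exact: tail.
move: lower upper.
(* The two finite bounds rule out both infinite values. *)
case: (integral _ _ _) => [r| |] //=; rewrite !lee_fin => lower upper.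
exists r => //.
have ? : 0 < p * (G 2^-1 - G 4^-1) by rewrite mulr_gt0// subr_gt0.
(* This is exactly the gap between [G 1 - L] and [B]. *)
have ? : 0 < (1 - q) * (G 1 - G 2^-1) by rewrite mulr_gt0 ?subr_gt0.
by rewrite (lt_le_trans _ lower)//= (le_lt_trans upper)// /B; lra.
Unshelve. all: by end_near.
Qed.

(** * The kernel and its arctangent primitive *)

(* The second arctangent takes [t^(-a)] rather than [t^a] so that the two
   terms agree at [t = 1]. *)
Definition poisson_primitive (R : realType) (a m c s t : R) : R :=
  atan ((t `^ a - m * c) / (m * s)) - atan ((t `^ (- a) - m * c) / (m * s)).

(** Up to a factor pi, the first summand is the half-plane Poisson kernel with pole [m * (c + i s)],
    taken at [t^a] and multiplied by the derivative of [t^a]. The weight [w] stands for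
    [lambda^(alpha n)]; [w = 1] gives the majorant that has an explicit primitive. *)
Definition poisson_kernel (R : realType) (a m c s w t : R) : R :=
  a * m * s * (t `^ (a - 1) *
    (((t `^ a - m * c) ^+ 2 + (m * s) ^+ 2)^-1 +
     w * ((m * t `^ a - c) ^+ 2 + s ^+ 2)^-1)).

Section Kernel.
Variables (R : realType) (a m c s : R).
Hypotheses (a0 : 0 < a) (m0 : 0 < m) (s0 : 0 < s) (cs1 : c ^+ 2 + s ^+ 2 = 1).

Lemma sqrD_gt0 (x y : R) : 0 < y -> 0 < x ^+ 2 + y ^+ 2.
Proof. by move=> y0; rewrite ltr_wpDl ?sqr_ge0// exprn_gt0. Qed.

Lemma is_derive_poisson_primitive (t : R) : 0 < t ->
  is_derive t 1 (poisson_primitive a m c s) (poisson_kernel a m c s 1 t).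
Proof.
move=> t0.
have ms0 : 0 < m * s by rewrite mulr_gt0.
have dpow b : is_derive t 1 (fun u : R => (u `^ b - m * c) / (m * s) : R)
    ((m * s)^-1 * (b * t `^ (b - 1))).
  have -> : (fun u : R => (u `^ b - m * c) / (m * s)) =
      (m * s)^-1 *: ((fun u => u `^ b) - cst (m * c)).
    by apply/funext => u; rewrite /= mulrC.
  have db := is_derive1_powR b t0.
  by apply: is_derive_eq; rewrite subr0.
have datan b := @is_derive1_comp _ (@atan R) _ t _ _ (is_derive1_atan _) (dpow b).
have dG : is_derive t 1 (poisson_primitive a m c s) _ :=
  is_deriveB (datan a) (datan (- a)).
apply: (is_derive_eq dG).
rewrite /poisson_kernel powRN !powRB; [|by rewrite (gt_eqF t0) implybT..].
rewrite powRN powRr1 ?ltW//.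
have : 0 < t `^ a by rewrite powR_gt0.
move: (t `^ a) => u u0.
have inv1D (x : R) :
    (1 + (x / (m * s)) ^+ 2)^-1 = (m * s) ^+ 2 / (x ^+ 2 + (m * s) ^+ 2).
  rewrite -[RHS]invf_div; congr (_^-1); by field; rewrite !gt_eqF.
(* With [z = c + i s] of modulus 1, this says that [|1 - m u z|] equals [|m u - z|]. *)
have D2E : u ^+ 2 * ((u^-1 - m * c) ^+ 2 + (m * s) ^+ 2) =
    (m * u - c) ^+ 2 + s ^+ 2.
  transitivity ((1 - m * u * c) ^+ 2 + (m * u * s) ^+ 2).
    by field; rewrite gt_eqF.
  transitivity (1 - 2 * m * u * c + (m * u) ^+ 2 * (c ^+ 2 + s ^+ 2)); first by ring.
  transitivity ((m * u) ^+ 2 - 2 * m * u * c + (c ^+ 2 + s ^+ 2)); last by ring.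
  by rewrite cs1; ring.
have D2inv : ((u^-1 - m * c) ^+ 2 + (m * s) ^+ 2)^-1 =
    u ^+ 2 * ((m * u - c) ^+ 2 + s ^+ 2)^-1.
  by rewrite -D2E invfM mulrA divff ?mul1r// sqrf_eq0 gt_eqF.
rewrite !inv1D D2inv.
move: (((u - m * c) ^+ 2 + (m * s) ^+ 2)^-1)
  (((m * u - c) ^+ 2 + s ^+ 2)^-1) => d1 d2.
by field; rewrite !gt_eqF//=.
Qed.

Lemma continuous_inv_sqrD (b d : R) : 0 < d ->
  continuous (fun u : R => ((u - b) ^+ 2 + d ^+ 2)^-1 : R).
Proof.
move=> d0 u; apply: cvgV; first by rewrite gt_eqF// sqrD_gt0.
apply: (@cvgD _ _ _ (nbhs u)); last exact: cvg_cst.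
apply: (@continuous_comp _ _ _ (fun v => v - b) (fun v => v ^+ 2));
  last exact: exprn_continuous.
by apply: (@cvgB _ _ _ (nbhs u)); [exact: cvg_id|exact: cvg_cst].
Qed.

Lemma continuous_powR (b t : R) : 0 < t -> {for t, continuous (fun u : R => u `^ b)}.
Proof.
move=> t0; have ? := is_derive1_powR b t0.
exact/differentiable_continuous/derivable1_diffP.
Qed.

Lemma continuous_poisson_kernel w (t : R) :
  0 < t -> {for t, continuous (poisson_kernel a m c s w)}.
Proof.
move=> t0; have ct b := @continuous_powR b t t0.
apply: (@cvgM _ _ (nbhs t)); first exact: cvg_cst.
apply: (@cvgM _ _ (nbhs t)); first exact: ct.
apply: (@cvgD _ _ _ (nbhs t)).
  apply: (@continuous_comp _ _ _ (fun u : R => u `^ a)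
    (fun u => ((u - m * c) ^+ 2 + (m * s) ^+ 2)^-1)); first exact: ct.
  by apply: continuous_inv_sqrD; rewrite mulr_gt0.
apply: (@cvgM _ _ (nbhs t)); first exact: cvg_cst.
apply: (@continuous_comp _ _ _ (fun u : R => m * u `^ a)
  (fun u => ((u - c) ^+ 2 + s ^+ 2)^-1)); last exact: continuous_inv_sqrD.
by apply: (@cvgM _ _ (nbhs t)); [exact: cvg_cst|exact: ct].
Qed.

Lemma measurable_poisson_kernel w : measurable_fun setT (poisson_kernel a m c s w).
Proof.
have mpow b : measurable_fun setT (fun u : R => u `^ b) by exact: measurable_powR.
have minv b d : 0 < d ->
    measurable_fun setT (fun u : R => ((u - b) ^+ 2 + d ^+ 2)^-1 : R).
  by move=> d0; apply: continuous_measurable_fun; exact: continuous_inv_sqrD.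
apply: measurable_funM => //; apply: measurable_funM => //.
apply: measurable_funD.
  by apply: (measurableT_comp (minv _ _ _)) => //; rewrite mulr_gt0.
apply: measurable_funM => //.
apply: (measurableT_comp (minv _ _ s0) (g := fun t : R => m * t `^ a)).
exact: measurable_funM.
Qed.

Lemma poisson_kernel_ge0 w t : 0 <= w -> 0 <= poisson_kernel a m c s w t.
Proof.
move=> w0; rewrite /poisson_kernel mulr_ge0//; first by rewrite !mulr_ge0// ltW.
rewrite mulr_ge0 ?powR_ge0// addr_ge0 ?mulr_ge0 ?invr_ge0//;
  by rewrite addr_ge0 ?sqr_ge0.
Qed.

Lemma le_poisson_kernel w1 w2 t :
  w1 <= w2 -> poisson_kernel a m c s w1 t <= poisson_kernel a m c s w2 t.
Proof.
move=> w12; rewrite /poisson_kernel ler_wpM2l//; first by rewrite !mulr_ge0// ltW.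
rewrite ler_wpM2l ?powR_ge0// lerD2l ler_wpM2r// invr_ge0.
by rewrite addr_ge0 ?sqr_ge0.
Qed.

(** Multiplying the kernel at weight 1 by [w] also shrinks the first summand. This bounds the
    weighted kernel below by a multiple of a function whose primitive is known. *)
Lemma poisson_kernel_scale_le w t :
  0 <= w <= 1 -> w * poisson_kernel a m c s 1 t <= poisson_kernel a m c s w t.
Proof.
move=> /andP[w0 w1]; rewrite /poisson_kernel mulrCA ler_wpM2l//.
  by rewrite !mulr_ge0// ltW.
rewrite mulrCA ler_wpM2l ?powR_ge0// mul1r mulrDr lerD2r ler_piMl// invr_ge0.
by rewrite addr_ge0 ?sqr_ge0.
Qed.

Lemma poisson_primitive_lt (t u : R) : 0 < t -> t < u ->
  poisson_primitive a m c s t < poisson_primitive a m c s u.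
Proof.
move=> t0 tu; have u0 := lt_trans t0 tu.
have ms0 : 0 < (m * s)^-1 by rewrite invr_gt0 mulr_gt0.
have tua : t `^ a < u `^ a by apply: gt0_ltr_powR => //; rewrite nnegrE ltW.
rewrite /poisson_primitive !powRN ltrD//; [|rewrite ltrN2]; apply: lt_atan;
  rewrite ltr_pM2r// ltrD2r//.
by rewrite ltf_pV2 ?posrE ?powR_gt0.
Qed.

Lemma poisson_primitive1 : poisson_primitive a m c s 1 = 0.
Proof. by rewrite /poisson_primitive !powR1 subrr. Qed.

(** The bound is the limit at 0: there [t^a] tends to 0 and [t^(-a)] to infinity. Each arctangent is
    compared with its own limit. *)
Lemma poisson_primitive_ge t :
  0 < t -> - (pi / 2 + atan (c / s)) <= poisson_primitive a m c s t.
Proof.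
move=> t0; rewrite opprD addrC /poisson_primitive lerD//;
  last by rewrite lerN2 ltW// atan_ltpi2.
rewrite -atanN -mulNr; apply: le_atan.
have -> : - c / s = - (m * c) / (m * s) by field; rewrite !gt_eqF.
rewrite ler_pM2r ?invr_gt0 ?mulr_gt0//.
by rewrite lerDr powR_ge0.
Qed.

End Kernel.

(** * Bounds for the weighted integral *)

Lemma weighted_poisson_kernel_integral (R : realType) (a m c s w x : R) :
  0 < a -> 0 < m -> 0 < s -> c ^+ 2 + s ^+ 2 = 1 -> 0 < w <= 1 -> 0 < x ->
  exists2 r : R, 0 < r < pi / 2 + atan (c / s) &
    (\int[lebesgue_measure]_(t in `[0%R, 1%R])
      ((1 - t) `^ x * poisson_kernel a m c s w t)%:E = r%:E)%E.
Proof.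
move=> a0 m0 s0 cs1 /andP[w0 w1] x0.
have one : 1 `^ x = 1 :> R by rewrite powR1.
have w_ge0 := ltW w0.
have half_lt1 : 2^-1 `^ x < 1 :> R.
  by rewrite -[ltRHS]one gt0_ltr_powR ?nnegrE//; lra.
have half_gt0 : 0 < 2^-1 `^ x :> R by rewrite powR_gt0.
have k0 w' t : 0 <= w' -> 0 <= poisson_kernel a m c s w' t
  by exact: poisson_kernel_ge0.
have kw t : poisson_kernel a m c s w t <= poisson_kernel a m c s 1 t
  by exact: le_poisson_kernel.
have -> : pi / 2 + atan (c / s) =
    poisson_primitive a m c s 1 - - (pi / 2 + atan (c / s)).
  by rewrite poisson_primitive1 sub0r opprK.
(* Both constants come from [1 - t = 1/2] at [t = 1/2]: the factor [(1 - t)^x] is at least [2^(-x)]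
   to the left of 1/2 and at most that to the right. The lower constant also pays [w] for the second
   summand. *)
apply: (integral_bounds_by_antiderivative (g := poisson_kernel a m c s 1)
  (p := 2^-1 `^ x * w) (q := 2^-1 `^ x)) => //.
- apply: measurable_funM; last exact: measurable_poisson_kernel.
  by apply: (measurableT_comp (measurable_powR _)); exact: measurable_funB.
- by move=> t t0; exact: continuous_poisson_kernel.
- by move=> t t0; exact: is_derive_poisson_primitive.
- by move=> t t0; exact: poisson_primitive_ge.
- by apply: poisson_primitive_lt => //; lra.
- by apply: poisson_primitive_lt => //; lra.
- move=> t /andP[t0 t1]; rewrite mulr_ge0 ?powR_ge0 ?k0//=.
  apply: le_trans (kw t); rewrite ler_piMl ?k0//.
  by rewrite -[leRHS]one ge0_ler_powR ?nnegrE//; lra.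
- by rewrite mulr_gt0.
- move=> t /andP[t4 t2]; rewrite -mulrA ler_pM ?powR_ge0//.
  + by rewrite mulr_ge0 ?k0// ltW.
  + by rewrite ge0_ler_powR ?nnegrE//; lra.
  + by apply: poisson_kernel_scale_le => //; rewrite w1 ltW.
- move=> t /andP[t2 t1]; rewrite ler_pM ?powR_ge0 ?k0//.
  by rewrite ge0_ler_powR ?nnegrE//; lra.
Qed.

(** * From complex moduli to the real kernel *)

Lemma normc_sqr_subM_expi (R : realType) (u m x : R) :
  Normc.normc (u%:C - m%:C * expi (- x))%C ^+ 2 =
  (u - m * cos x) ^+ 2 + (m * sin x) ^+ 2.
Proof.
rewrite /expi cosN sinN /= sqr_sqrtr; last by rewrite addr_ge0// sqr_ge0.
by ring.
Qed.

Lemma normc_sqr_expi_sub (R : realType) (v x : R) :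
  Normc.normc (expi (- x) - v%:C)%C ^+ 2 = (v - cos x) ^+ 2 + sin x ^+ 2.
Proof.
rewrite /expi cosN sinN /= sqr_sqrtr; last by rewrite addr_ge0// sqr_ge0.
by ring.
Qed.

(** Only the square of the sine enters the moduli, so a positive [s] serves both signs of
    [sin (a * pi)]; the sign returns as the quotient [sin (a * pi) / s]. *)
Lemma remainder_poisson_kernel (R : realType) (a l s r : R) (n : nat) :
  0 < a -> 0 < l -> 0 < s -> s ^+ 2 = sin (a * pi) ^+ 2 ->
  (\int[lebesgue_measure]_(t in `[0%R, 1%R])
    ((1 - t) `^ (a * n%:R) *
     poisson_kernel a (l `^ a) (cos (a * pi)) s (l `^ (a * n%:R)) t)%:E =
   r%:E)%E ->
  remainder a n l = sin (a * pi) / s * (r / pi).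
Proof.
move=> a0 l0 s0 s2 rE; rewrite /remainder /Rintegral.
set m := l `^ a; set x := a * n%:R; set c := cos (a * pi).
set w := l `^ x.
have m0 : 0 < m by rewrite powR_gt0.
have ams0 : 0 < a * m * s by rewrite !mulr_gt0.
under eq_integral => t.
  rewrite inE/= in_itv/= => /andP[t0 _].
  rewrite powRM//; last exact: ltW.
  rewrite normc_sqr_subM_expi normc_sqr_expi_sub exprMn -s2 -exprMn -/c -/m.
  (* The identity is pointwise on all of [0, 1]: at [t = 0] both sides carry the same value of the
     power with exponent [a - 1]. *)
  have -> : t `^ (a - 1) * (1 - t) `^ x *
      (1 / ((t `^ a - m * c) ^+ 2 + (m * s) ^+ 2) +
       w / ((m * t `^ a - c) ^+ 2 + s ^+ 2)) =
      (a * m * s)^-1 * ((1 - t) `^ x * poisson_kernel a m c s w t).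
    rewrite /poisson_kernel [in RHS]mulrCA mulKf ?gt_eqF//.
    by rewrite div1r [in LHS](mulrC (t `^ _)) mulrA.
  rewrite EFinM.
  over.
rewrite ge0_integralZl_EFin//=.
- rewrite rE /=; move: (sin _) (pi_gt0 R); generalize (@pi R) => p y p0.
  by field; rewrite !gt_eqF.
- move=> t _; rewrite lee_fin mulr_ge0 ?powR_ge0//.
  by rewrite poisson_kernel_ge0// powR_ge0.
- apply/measurable_EFinP/measurable_funTS/measurable_funM.
    by apply: (measurableT_comp (measurable_powR _)); exact: measurable_funB.
  exact: measurable_poisson_kernel.
- by rewrite invr_ge0 ltW.
Qed.

(** * Evaluation of the bound in the two ranges of alpha *)

(** The cotangent of [x] is the tangent of [pi / 2 - x], which lies in the range of [atan]. *)
Lemma atan_cot (R : realType) (x : R) : 0 < x < pi ->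
  atan (cos x / sin x) = pi / 2 - x.
Proof.
move=> /andP[x0 xpi]; rewrite -[RHS]tanK; last first.
  by rewrite in_itv/=; apply/andP; split; lra.
by rewrite /tan -opprB sinN cosN sinBpihalf cosBpihalf opprK.
Qed.

Theorem proposition2p6 (R : realType) (n : nat) (lambda : R)
    (hn : (1 <= n)%N) (hl0 : 0 < lambda) (hl1 : lambda <= 1) :
  (forall alpha : R, 0 < alpha -> alpha < 1 ->
     [/\ 0 < remainder alpha n lambda,
         remainder alpha n lambda < 1 - alpha
       & 1 - alpha < 1]) /\
  (forall alpha : R, 1 < alpha -> alpha < 2 ->
     [/\ 0 > remainder alpha n lambda,
         remainder alpha n lambda > 1 - alpha
       & 1 - alpha > -1]).
Proof.
have pi0 : 0 < pi :> R := pi_gt0 R.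
have ipi0 : 0 < pi^-1 :> R by rewrite invr_gt0.
have bounds (a s : R) : 0 < a -> 0 < s -> s ^+ 2 = sin (a * pi) ^+ 2 ->
    exists2 r : R, 0 < r < pi / 2 + atan (cos (a * pi) / s) &
      remainder a n lambda = sin (a * pi) / s * (r / pi).
  move=> a0 s0 s2.
  have [||||||r rb rE] := @weighted_poisson_kernel_integral R a (lambda `^ a)
    (cos (a * pi)) s (lambda `^ (a * n%:R)) (a * n%:R) => //.
  - by rewrite powR_gt0.
  - by rewrite s2 cos2Dsin2.
  - rewrite powR_gt0//= (le_trans (ge0_ler_powR _ _ _ hl1)) ?powR1 ?nnegrE//.
      by rewrite mulr_ge0// ltW.
    exact: ltW.
  - by rewrite mulr_gt0// ltr0n.
  by exists r => //; exact: remainder_poisson_kernel rE.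
split=> a.
- move=> a0 a1; have s0 : 0 < sin (a * pi).
    by rewrite sin_gt0_pi// mulr_gt0//= gtr_pMl.
  have [r /andP[r0 rb] ->] := bounds a (sin (a * pi)) a0 s0 erefl.
  rewrite divff ?gt_eqF// mul1r; split; [by rewrite mulr_gt0| |by lra].
  rewrite ltr_pdivrMr//; apply: lt_le_trans rb _.
  by rewrite atan_cot ?mulr_gt0//= ?gtr_pMl//; lra.
(* Shifting the angle by [pi] brings it back into [(0, pi)] and negates sine and cosine. With
   [s = sin b] the bound becomes [pi / 2 - (pi / 2 - b) = b], and the remainder is [- (r / pi)]. *)
- move=> a1 a2; pose b := (a - 1) * pi.
  have bpi : 0 < b < pi by rewrite /b mulr_gt0 ?subr_gt0//= gtr_pMl//; lra.
  have aE : a * pi = b + pi by rewrite /b; ring.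
  have sE : sin (a * pi) = - sin b by rewrite aE sinDpi.
  have cE : cos (a * pi) = - cos b by rewrite aE cosDpi.
  have s0 : 0 < sin b by exact: sin_gt0_pi.
  have [||r /andP[r0 rb] ->] := bounds a (sin b) _ s0; first by lra.
    by rewrite sE sqrrN.
  have rpi : 0 < r / pi by rewrite mulr_gt0.
  have rpi1 : r / pi < a - 1.
    rewrite ltr_pdivrMr//; apply: lt_le_trans rb _.
    by rewrite cE mulNr atanN atan_cot// -/b; lra.
  by rewrite sE mulNr divff ?gt_eqF// mulN1r; split; lra.
Qed.
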